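(* Let $A\in\mathbb{Z}^{m\times n}$ be an integer matrix, let $A_B\in\mathbb{Z}^{m\times q}$ be its bouquet matrix, and let $T:\operatorname{Ker}_{\mathbb{Z}}(A)\to\operatorname{Ker}_{\mathbb{Z}}(A_B)$ be the isomorphism described in the context. If $\{\mathbf{u}_1,\ldots,\mathbf{u}_t\}$ is a minimal Markov basis of $A$, then $\{T(\mathbf{u}_1),\ldots,T(\mathbf{u}_t)\}$ is a Markov basis of $A_B$ (not necessarily minimal).
   Context: For an integer matrix $M$ with $N$ columns, a Markov basis of $M$ is a finite set $\mathcal{M}\subseteq\operatorname{Ker}_{\mathbb{Z}}(M)$ such that whenever $\mathbf{w},\mathbf{u}\in\mathbb{N}^N$ with $\mathbf{w}-\mathbf{u}\in\operatorname{Ker}_{\mathbb{Z}}(M)$, there exist $\mathbf{v}_1,\ldots,\mathbf{v}_p\in\mathcal{M}\cup(-\mathcal{M})$ with $\mathbf{w}-\sum_{i=1}^l\mathbf{v}_i\in\mathbb{N}^N$ for all $1\le l\le p$ and $\mathbf{w}-\mathbf{u}=\sum_{i=1}^p\mathbf{v}_i$. It is minimal if no proper subset is a Markov basis. Bouquets. Let $A=[\mathbf{a}_1,\ldots,\mathbf{a}_n]\in\mathbb{Z}^{m\times n}$. Fix a matrix whose columns form a $\mathbb{Z}$-basis of $\operatorname{Ker}_{\mathbb{Z}}(A)$, and let the Gale transform $G(\mathbf{a}_i)$ be its $i$-th row. Call $i\neq j$ adjacent if there is $\mathbf{v}\in\mathbb{Z}^m$ such that $\mathbf{v}\cdot A$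 has nonzero entries exactly in positions $i$ and $j$; the bouquets of $A$ are the classes of the equivalence relation on the columns generated by adjacency. A bouquet is free if $G(\mathbf{a}_i)=\mathbf{0}$ for its columns (equivalently, $i$ lies outside the support of every element of $\operatorname{Ker}_{\mathbb{Z}}(A)$); otherwise it is non-free, and then all $G(\mathbf{a}_i)$, $\mathbf{a}_i\in B$, are nonzero and pairwise linearly dependent. For each bouquet $B$ define $\mathbf{c}_B\in\mathbb{Z}^n$: if $B$ is free, $\mathbf{c}_B$ is any nonzero vector with support $\{i:\mathbf{a}_i\in B\}$ whose first nonzero coordinate is positive; if $B$ is non-free, pick a coordinate $j$ with $G(\mathbf{a}_i)_j\neq0$ for all $\mathbf{a}_i\in B$, let $g=\gcd(G(\mathbf{a}_i)_j:\mathbf{a}_i\in B)$, let $i_0$ be the smallest index with $\mathbf{a}_{i_0}\in B$, let $\varepsilon$ be the sign of $G(\mathbf{a}_{i_0})_j$, and set $(\mathbf{c}_B)_i=\varepsilon G(\mathbf{a}_i)_j/g$ if $\mathbf{a}_i\in B$ and $0$ otherwise. Set $\mathbf{a}_B=\sum_{i=1}^n(\mathbf{c}_B)_i\mathbf{a}_i\in\mathbb{Z}^m$. If $B_1,\ldots,B_q$ are the bouquets of $A$, the bouquet matrix is $A_B=[\mathbf{a}_{B_1},\ldots,\mathbf{a}_{B_q}]\in\mathbb{Z}^{m\times q}$. Let $j_k=\min\operatorname{supp}(\mathbf{c}_{B_k})$, so $(\mathbf{c}_{B_k})_{j_k}>0$. The map $D:\operatorname{Ker}_{\mathbb{Z}}(A_B)\to\operatorname{Ker}_{\mathbb{Z}}(A)$,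 $D(u_1,\ldots,u_q)=\sum_k u_k\mathbf{c}_{B_k}$, is a (known) isomorphism, and its inverse $T$ is given by $T(\mathbf{v})=(v_{j_1}/(\mathbf{c}_{B_1})_{j_1},\ldots,v_{j_q}/(\mathbf{c}_{B_q})_{j_q})$. *)

(* Defs.v *)
From Stdlib Require Export Relation_Operators.
From mathcomp Require Export all_boot all_order all_algebra finmap.

Set Implicit Arguments.
Unset Strict Implicit.
Unset Printing Implicit Defensive.

Import Order.TTheory GRing.Theory Num.Theory.
Local Open Scope ring_scope.
Local Open Scope fset_scope.

Definition in_ker (m n : nat) (A : 'M[int]_(m, n)) (v : 'cV[int]_n) : Prop :=
  A *m v = 0.

Definition nonneg (n : nat) (v : 'cV[int]_n) : Prop :=
  forall i : 'I_n, 0 <= v i 0.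

(* The steps v_1, ..., v_p are the entries of s; p = 0 is allowed (w = u). *)
Definition markov_basis (m n : nat) (A : 'M[int]_(m, n))
    (M : {fset 'cV[int]_n}) : Prop :=
  (forall v, v \in M -> in_ker A v) /\
  (forall w u : 'cV[int]_n, nonneg w -> nonneg u -> in_ker A (w - u) ->
    exists s : seq 'cV[int]_n,
      [/\ forall v, v \in s -> v \in M \/ - v \in M,
          forall l : nat, (1 <= l <= size s)%N ->
            nonneg (w - \sum_(v <- take l s) v)
        & w - u = \sum_(v <- s) v]).

Definition minimal_markov_basis (m n : nat) (A : 'M[int]_(m, n))
    (M : {fset 'cV[int]_n}) : Prop :=
  markov_basis A M /\ (forall M', M' `<` M -> ~ markov_basis A M').

(* The columns of G form a Z-basis of Ker_Z(A); the Gale transform of the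
   i-th column of A is then row i G. *)
Definition ker_basis (m n r : nat) (A : 'M[int]_(m, n)) (G : 'M[int]_(n, r)) :
    Prop :=
  [/\ forall j : 'I_r, in_ker A (col j G),
      forall v, in_ker A v -> exists x : 'cV[int]_r, v = G *m x
    & forall x : 'cV[int]_r, G *m x = 0 -> x = 0].

Definition adjacent (m n : nat) (A : 'M[int]_(m, n)) (i j : 'I_n) : Prop :=
  i != j /\
  exists v : 'rV[int]_m,
    forall k : 'I_n, (v *m A) 0 k != 0 <-> k = i \/ k = j.

Definition is_bouquet (m n : nat) (A : 'M[int]_(m, n)) (B : {set 'I_n}) : Prop :=
  exists i : 'I_n,
    forall j : 'I_n, j \in B <-> clos_refl_sym_trans 'I_n (adjacent A) i j.

Definition bouquet_enum (m n q : nat) (A : 'M[int]_(m, n))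
    (B : 'I_q -> {set 'I_n}) : Prop :=
  injective B /\ (forall S, is_bouquet A S <-> exists k, S = B k).

Definition is_min (n : nat) (S : {set 'I_n}) (i : 'I_n) : Prop :=
  i \in S /\ (forall i', i' \in S -> (i <= i')%N).

Definition supp (n : nat) (v : 'cV[int]_n) : {set 'I_n} :=
  [set i | v i 0 != 0].

Definition free_bouquet (n r : nat) (G : 'M[int]_(n, r)) (B : {set 'I_n}) :
    Prop :=
  forall i, i \in B -> row i G = 0.

(* c is an admissible choice of c_B for the bouquet B, relative to G. *)
Definition bouquet_vector (n r : nat) (G : 'M[int]_(n, r)) (B : {set 'I_n})
    (c : 'cV[int]_n) : Prop :=
  (free_bouquet G B ->
     supp c = B /\ (forall i0, is_min (supp c) i0 -> 0 < c i0 0)) /\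
  (~ free_bouquet G B ->
     exists (j : 'I_r) (i0 : 'I_n),
       [/\ forall i, i \in B -> G i j != 0,
           is_min B i0
         & forall i, c i 0 =
             if i \in B then
               divz (Num.sg (G i0 j) * G i j) (\big[gcdz/0]_(l in B) G l j)
             else 0]).

Definition bouquet_matrix (m n q : nat) (A : 'M[int]_(m, n))
    (c : 'I_q -> 'cV[int]_n) : 'M[int]_(m, q) :=
  \matrix_(i < m, k < q) (\sum_(l < n) c k l 0 *: col l A) i 0.

(* The division is exact for v in Ker_Z(A) when j k = min (supp (c k)). *)
Definition bouquet_T (n q : nat) (c : 'I_q -> 'cV[int]_n) (j : 'I_q -> 'I_n)
    (v : 'cV[int]_n) : 'cV[int]_q :=
  \col_(k < q) divz (v (j k) 0) (c k (j k) 0).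

(* Main.v *)
(** Write [D x = \sum_k x_k c_k], so that [A_B x = A (D x)].  Inside a bouquet
    the rows of [G] are proportional, hence every kernel vector of [A] restricts
    there to an integral multiple of [c_B], and [D], [T] are mutually inverse.
    Given nonnegative [w], [u] with [w - u] in the kernel of [A_B], split
    [D (w - u)] into its positive and negative parts and connect these by a
    Markov path of [A].  Reading the path at the coordinates [j_k], where
    [c_k (j_k) > 0], shows that its image under [T] keeps [(w - u)^+], and a
    fortiori [w >= (w - u)^+], nonnegative. *)

From mathcomp Require Import boolp.
Require Import Defs.

Set Implicit Arguments.
Unset Strict Implicit.
Unset Printing Implicit Defensive.

Import Order.TTheory GRing.Theory Num.Theory.
Local Open Scope ring_scope.

(** By Bezout the gcd is an integral combination of the [F i]. The same combination of the [v i]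
    gives [t], so one [t] serves all [k]. *)
Lemma big_gcdz_combination (I J : Type) (s : seq I) (P : pred I) (F v : I -> int)
    (a b : J -> int) :
  (forall i k, P i -> F i * a k = v i * b k) ->
  exists t, forall k, (\big[gcdz/0]_(i <- s | P i) F i) * a k = t * b k.
Proof.
move=> Fv; elim/big_rec: _ => [|i g Pi [t tP]]; first by exists 0 => k; rewrite !mul0r.
have [x [y <-]] := Bezoutz (F i) g.
exists (x * v i + y * t) => k.
by rewrite !mulrDl -!mulrA Fv // tP.
Qed.

Lemma big_gcdz_dvd (I : finType) (P : pred I) (F : I -> int) (i : I) :
  P i -> (\big[gcdz/0]_(l | P l) F l %| F i)%Z.
Proof.
move=> Pi; have := mem_index_enum i.
elim: (index_enum I) => // k s IHs; rewrite big_cons inE => /predU1P[<-|/IHs div_i].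
  by rewrite Pi dvdz_gcdl.
by case: (P k) => //; apply: dvdz_trans (dvdz_gcdr _ _) div_i.
Qed.

Lemma big_gcdz_ge0 (I : Type) (s : seq I) (P : pred I) (F : I -> int) :
  0 <= \big[gcdz/0]_(l <- s | P l) F l.
Proof. by elim/big_rec: _. Qed.

(** The row [y *m A] annihilates the kernel and has only two nonzero entries, so it ties the two
    coordinates by coefficients independent of [v]. *)
Lemma adjacent_proportional (m n : nat) (A : 'M[int]_(m, n)) (i l : 'I_n) :
  adjacent A i l ->
  exists a b : int, [/\ a != 0, b != 0 &
    forall v, in_ker A v -> a * v i 0 = b * v l 0].
Proof.
case=> il [y]; set z := y *m A => zP; exists (z 0 i), (- z 0 l); split.
- by apply/zP; left.
- by rewrite oppr_eq0; apply/zP; right.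
move=> v vK; have /matrixP/(_ 0 0) : z *m v = 0 by rewrite -mulmxA vK mulmx0.
(* Only the support of [z] matters from here on. *)
move: (z) zP => {}z zP.
rewrite !mxE (bigD1 i) //= (bigD1 l) 1?(eq_sym l) //= big1 ?addr0; last first.
  move=> k /andP[ki kl]; have [->|/zP[]] := eqVneq (z 0 k) 0.
  - by rewrite mul0r.
  - by move=> kE; rewrite kE eqxx in ki.
  - by move=> kE; rewrite kE eqxx in kl.
by move/eqP; rewrite addr_eq0 mulNr => /eqP.
Qed.

Lemma class_proportional (m n : nat) (A : 'M[int]_(m, n)) (i l : 'I_n) :
  clos_refl_sym_trans 'I_n (adjacent A) i l ->
  exists a b : int, [/\ a != 0, b != 0 &
    forall v, in_ker A v -> a * v i 0 = b * v l 0].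
Proof.
elim=> {i l} [i l|i|i l _ [a [b [a0 b0 P]]]|
  i k l _ [a [b [a0 b0 P]]] _ [a' [b' [a0' b0' P']]]].
- exact: adjacent_proportional.
- by exists 1, 1.
- by exists b, a; split=> // v /P ->.
- exists (a' * a), (b * b'); split; rewrite ?mulf_neq0 // => v vK.
  by rewrite -!mulrA P // -P' // mulrCA.
Qed.

(** The common ratio of the two coordinates is eliminated: the 2 by 2 minor formed from [u] and [v]
    vanishes. *)
Lemma class_cross_mul (m n : nat) (A : 'M[int]_(m, n)) (i l : 'I_n)
    (u v : 'cV[int]_n) :
  clos_refl_sym_trans 'I_n (adjacent A) i l -> in_ker A u -> in_ker A v ->
  u l 0 * v i 0 = v l 0 * u i 0.
Proof.
move=> /class_proportional[a [b [a0 b0 P]]] uK vK; apply: (mulfI a0).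
by rewrite mulrCA (P v) // [RHS]mulrCA (P u) // mulrCA [RHS]mulrCA [u l 0 * _]mulrC.
Qed.

Lemma is_min_unique (n : nat) (S : {set 'I_n}) (i l : 'I_n) :
  is_min S i -> is_min S l -> i = l.
Proof.
move=> [iS iP] [lS lP]; apply/val_inj/eqP.
by rewrite eqn_leq iP // lP.
Qed.

Lemma bouquet_class (m n q : nat) (A : 'M[int]_(m, n))
    (B : 'I_q -> {set 'I_n}) (hB : bouquet_enum A B) (k : 'I_q) (i l : 'I_n) :
  i \in B k -> (l \in B k <-> clos_refl_sym_trans 'I_n (adjacent A) i l).
Proof.
have [_ /(_ (B k))[_ /(_ (ex_intro _ k erefl))[i0 BP]]] := hB.
move=> /BP i0i; split=> [/BP i0l|il].
  exact: rst_trans (rst_sym _ _ _ _ i0i) i0l.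
by apply/BP; apply: rst_trans i0i il.
Qed.

Lemma bouquet_cover (m n q : nat) (A : 'M[int]_(m, n))
    (B : 'I_q -> {set 'I_n}) (hB : bouquet_enum A B) (i : 'I_n) :
  exists k, i \in B k.
Proof.
pose S := [set l | `[< clos_refl_sym_trans 'I_n (adjacent A) i l >]].
have SP l : l \in S <-> clos_refl_sym_trans 'I_n (adjacent A) i l.
  by rewrite inE; split=> /asboolP.
have [_ /(_ S)[/(_ (ex_intro _ i SP))[k SB] _]] := hB.
by exists k; rewrite -SB; apply/SP; apply: rst_refl.
Qed.

Lemma bouquet_disjoint (m n q : nat) (A : 'M[int]_(m, n))
    (B : 'I_q -> {set 'I_n}) (hB : bouquet_enum A B) (k k' : 'I_q) (i : 'I_n) :
  i \in B k -> i \in B k' -> k = k'.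
Proof.
have [injB _] := hB; move=> ik ik'; apply: injB; apply/setP => l.
have Bk := bouquet_class hB l ik; have Bk' := bouquet_class hB l ik'.
by apply/idP/idP => [/Bk/Bk'|/Bk'/Bk].
Qed.

(** Gives the free and non-free cases a common form, sufficient for reading off and comparing
    coefficients. *)
Lemma bouquet_vector_supp (n r : nat) (G : 'M[int]_(n, r)) (B : {set 'I_n})
    (c : 'cV[int]_n) (j : 'I_n) :
  bouquet_vector G B c -> is_min (supp c) j -> supp c = B /\ 0 < c j 0.
Proof.
move=> [cfree cnonfree] jmin.
have [/cfree[suppE cpos]|/cnonfree[j' [i0 [G0 i0min cE]]]] :=
  EM (free_bouquet G B); first by split=> //; apply: cpos.
set g := \big[gcdz/0]_(l in B) G l j' in cE.
have cG i : i \in B -> c i 0 * g = Num.sg (G i0 j') * G i j'.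
  by move=> iB; rewrite cE iB divzK // dvdz_mull // (big_gcdz_dvd (fun l => G l j')).
have suppE : supp c = B.
  apply/setP => i; rewrite inE; case: (boolP (i \in B)) => iB; last first.
    by rewrite cE (negbTE iB) eqxx.
  apply/eqP => ci0; have /esym/eqP := cG i iB.
  by rewrite ci0 mul0r mulf_eq0 sgr_eq0 !(negbTE (G0 _ _)) // i0min.1.
split=> //; rewrite suppE in jmin.
rewrite (is_min_unique jmin i0min).
(* At [i0] the sign factor turns the entry of [G] into its absolute value. *)
have gc : 0 < c i0 0 * g by rewrite cG ?i0min.1 // -normrEsg normr_gt0 G0 // i0min.1.
have g0 : 0 < g.
  by rewrite lt_def big_gcdz_ge0 andbT; apply: contraL gc => /eqP ->; rewrite mulr0 ltxx.
by rewrite -(pmulr_lgt0 _ g0).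
Qed.

(* Integrality of the multiple comes from Bezout: the entries of [c] on a
   non-free bouquet have gcd one. *)
Lemma ker_bouquet_multiple (m n r q : nat) (A : 'M[int]_(m, n))
    (G : 'M[int]_(n, r)) (hG : ker_basis A G)
    (B : 'I_q -> {set 'I_n}) (hB : bouquet_enum A B) (k : 'I_q)
    (c : 'cV[int]_n) (hc : bouquet_vector G (B k) c) (v : 'cV[int]_n) :
  in_ker A v -> exists t, forall i, i \in B k -> v i 0 = t * c i 0.
Proof.
move=> vK; have [colK Gspan _] := hG; have [_ cnonfree] := hc.
have [free|/cnonfree[j [i0 [G0 i0min cE]]]] := EM (free_bouquet G (B k)).
  exists 0 => i iB; rewrite mul0r; have [x ->] := Gspan v vK.
  have /rowP/(_ 0) : row i (G *m x) = 0 by rewrite row_mul free // mul0mx.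
  by rewrite !mxE.
set g := \big[gcdz/0]_(l in B k) G l j in cE.
have gG i : i \in B k -> (g %| G i j)%Z
  by move=> iB; apply: (big_gcdz_dvd (fun l => G l j)).
have i0B := i0min.1.
have g0 : g != 0.
  by apply: contraNneq (G0 _ i0B) => gE; have := gG _ i0B; rewrite gE dvd0z.
(* Column [j] of [G] lies in the kernel, hence is proportional to [v] on the bouquet. The sigma type
   restricts the indices to those where this is known. *)
have [t tP] : exists t, forall i : {i | i \in B k},
    g * v (val i) 0 = t * G (val i) j.
  apply: (@big_gcdz_combination _ _ _ _ _ (fun l => v l 0)
    (fun i => v (val i) 0) (fun i => G (val i) j)) => l i lB.
  have := class_cross_mul ((bouquet_class hB l (valP i)).1 lB) (colK j) vK.
  by rewrite !mxE.
exists (Num.sg (G i0 j) * t) => i iB; apply: (mulfI g0).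
rewrite (tP (exist _ i iB)) /= mulrCA cE iB [g * _]mulrC divzK ?dvdz_mull ?gG //.
(* The sign in the witness cancels the one in [c]. *)
by rewrite mulrACA -expr2 sqr_sg G0 // mul1r.
Qed.

Definition bouquet_D (n q : nat) (c : 'I_q -> 'cV[int]_n) (x : 'cV[int]_q) :
    'cV[int]_n :=
  \sum_(k < q) x k 0 *: c k.

Lemma bouquet_matrixE (m n q : nat) (A : 'M[int]_(m, n))
    (c : 'I_q -> 'cV[int]_n) (x : 'cV[int]_q) :
  bouquet_matrix A c *m x = A *m bouquet_D c x.
Proof.
apply/colP => i; rewrite mulmx_sumr summxE !mxE; apply: eq_bigr => k _.
rewrite -scalemxAr !mxE mulrC summxE; congr (_ * _); apply: eq_bigr => l _.
by rewrite !mxE mulrC.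
Qed.

Lemma supp_notin (n : nat) (c : 'cV[int]_n) (i : 'I_n) :
  i \notin supp c -> c i 0 = 0.
Proof. by rewrite inE negbK => /eqP. Qed.

Lemma bouquet_DE (m n q : nat) (A : 'M[int]_(m, n))
    (B : 'I_q -> {set 'I_n}) (hB : bouquet_enum A B)
    (c : 'I_q -> 'cV[int]_n) (hs : forall k, supp (c k) = B k)
    (x : 'cV[int]_q) (k : 'I_q) (i : 'I_n) :
  i \in B k -> bouquet_D c x i 0 = x k 0 * c k i 0.
Proof.
move=> iB; rewrite summxE (bigD1 k) //= big1 ?addr0 ?mxE // => k' k'k.
rewrite mxE (@supp_notin _ (c k')) ?mulr0 // hs; apply: contra k'k => iB'.
by rewrite (bouquet_disjoint hB iB' iB).
Qed.

(** On [B k] the vector [v] is [t] times [c k]; dividing at [j k], where [c k] is nonzero, recovers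
    exactly [t]. *)
Lemma bouquet_TK (m n r q : nat) (A : 'M[int]_(m, n))
    (G : 'M[int]_(n, r)) (hG : ker_basis A G)
    (B : 'I_q -> {set 'I_n}) (hB : bouquet_enum A B)
    (c : 'I_q -> 'cV[int]_n) (hc : forall k, bouquet_vector G (B k) (c k))
    (j : 'I_q -> 'I_n) (hj : forall k, is_min (supp (c k)) (j k))
    (v : 'cV[int]_n) :
  in_ker A v -> bouquet_D c (bouquet_T c j v) = v.
Proof.
move=> vK; have hs k := (bouquet_vector_supp (hc k) (hj k)).1.
apply/colP => i; have [k iB] := bouquet_cover hB i.
rewrite (bouquet_DE hB hs _ iB).
have [t tP] := ker_bouquet_multiple hG hB (hc k) vK.
have jB : j k \in B k by rewrite -hs; apply: (hj k).1.
by rewrite mxE !tP // mulzK //; have := (hj k).1; rewrite inE.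
Qed.

Local Open Scope fset_scope.

Theorem theorem3p1 (m n r q : nat) (A : 'M[int]_(m, n))
    (G : 'M[int]_(n, r)) (hG : ker_basis A G)
    (B : 'I_q -> {set 'I_n}) (hB : bouquet_enum A B)
    (c : 'I_q -> 'cV[int]_n) (hc : forall k, bouquet_vector G (B k) (c k))
    (j : 'I_q -> 'I_n) (hj : forall k, is_min (supp (c k)) (j k))
    (M : {fset 'cV[int]_n}) (hM : minimal_markov_basis A M) :
  markov_basis (bouquet_matrix A c) (bouquet_T c j @` M).
Proof.
have [[MK Mpath] _] := hM.
have TK := bouquet_TK hG hB hc hj.
have hs k := (bouquet_vector_supp (hc k) (hj k)).1.
have cpos k := (bouquet_vector_supp (hc k) (hj k)).2.
have cneq k : c k (j k) 0 != 0 by rewrite gt_eqF.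
have Dj x k : bouquet_D c x (j k) 0 = x k 0 * c k (j k) 0.
  by apply: (bouquet_DE hB hs); rewrite -hs; apply: (hj k).1.
have Tj v k : in_ker A v -> bouquet_T c j v k 0 * c k (j k) 0 = v (j k) 0.
  by move=> vK; rewrite -Dj TK.
split=> [_ /imfsetP[v /= vM ->]|w u w0 u0 wuK].
  by rewrite /in_ker bouquet_matrixE TK //; apply: MK.
set d := bouquet_D c (w - u).
have dK : in_ker A d by rewrite /in_ker -bouquet_matrixE.
(* [p] is the positive part of [d], and [p - d] its negative part. *)
pose p := (\col_i Num.max (d i 0) 0 : 'cV[int]_n)%R.
have p_ge0 : nonneg p by move=> i; rewrite mxE le_max lexx orbT.
have pd_ge0 : nonneg (p - d) by move=> i; rewrite !mxE subr_ge0 le_max lexx.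
have [|s [sM spos sE]] := Mpath p (p - d) p_ge0 pd_ge0; first by rewrite subKr.
rewrite subKr in sE.
have sK v : v \in s -> in_ker A v.
  by case/sM => /MK // /eqP; rewrite mulmxN oppr_eq0 => /eqP.
(* Integer division is not additive, so sums are compared after multiplying by [c k (j k) 0]; on
   kernel vectors the division is exact. *)
have sumTj (s' : seq 'cV[int]_n) k : {subset s' <= s} ->
    (\sum_(v <- s') bouquet_T c j v)%R k 0 * c k (j k) 0 = (\sum_(v <- s') v)%R (j k) 0.
  move=> s's; rewrite !summxE mulr_suml big_seq [RHS]big_seq.
  by apply: eq_bigr => v /s's/sK; apply: Tj.
exists [seq bouquet_T c j v | v <- s]; split.
- move=> _ /mapP[v vs ->]; have [vM|vM] := sM v vs; [left|right].
    by apply/imfsetP; exists v.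
  apply/imfsetP; exists (- v)%R => //; apply/colP => k; apply: (mulIf (cneq k)).
  rewrite [RHS]Tj; last exact: MK.
  by rewrite mxE mulNr Tj ?mxE; last exact: sK.
- move=> l; rewrite size_map => lP k; rewrite -map_take big_map.
  rewrite -(pmulr_lge0 _ (cpos k)); have := spos l lP (j k).
  rewrite !mxE mulrBl sumTj => [/le_trans|v]; last exact: mem_take.
  (* What remains is that the positive part of [w - u] is at most [w], which follows from [u] and
     [w] being nonnegative. *)
  apply; rewrite lerD2r Dj ge_max !mxE ler_pM2r // gerBl; apply/andP; split.
    exact: u0.
  by rewrite mulr_ge0 ?(ltW (cpos k)) //; apply: w0.
- rewrite big_map; apply/colP => k; apply: (mulIf (cneq k)).
  by rewrite sumTj // -sE Dj.
Qed.
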